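(* Let $\Lambda$ be a hereditary QF-$3^{+}$ ring. The category $\Lambda\text{-}Mod_{Pr}$ of projective modules is Abelian if and only if the ring $\Lambda$ is semisimple.
   Context: Rings are associative with identity; modules are left unital $\Lambda$-modules, and $\Lambda\text{-}Mod_{Pr}$ is the full subcategory of the category of modules consisting of the projective ones. A ring $\Lambda$ is left QF-$3^{+}$ if the injective envelope of the left module ${}_\Lambda\Lambda$ is projective; a left hereditary left QF-$3^{+}$ ring is also right hereditary and right QF-$3^{+}$, so one speaks of hereditary QF-$3^{+}$ rings. A ring is semisimple if all its left modules are semisimple (equivalently, projective). *)

(* Defs.v *)
From HB Require Import structures.
From mathcomp Require Import all_boot all_algebra.
From mathcomp Require Import boolp.

Set Implicit Arguments.
Unset Strict Implicit.
Unset Printing Implicit Defensive.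

Import GRing.Theory.
Local Open Scope ring_scope.

(* Composition is in the usual order: [mcomp g f] is "g after f". *)
Record category := Category {
  obj : Type;
  hom : obj -> obj -> Type;
  idm : forall A, hom A A;
  mcomp : forall A B C, hom B C -> hom A B -> hom A C;
  mcompA : forall A B C D (h : hom C D) (g : hom B C) (f : hom A B),
    mcomp h (mcomp g f) = mcomp (mcomp h g) f;
  mcomp1m : forall A B (f : hom A B), mcomp (idm B) f = f;
  mcompm1 : forall A B (f : hom A B), mcomp f (idm A) = f
}.

Arguments hom {_}.
Arguments idm {_}.
Arguments mcomp {_ _ _ _}.

Definition full_subcategory (C : category) (P : obj C -> Prop) : category :=
  @Category {A : obj C | P A} (fun A B => hom (sval A) (sval B))
    (fun A => idm (sval A)) (fun A B D g f => mcomp g f)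
    (fun A B D E h g f => mcompA h g f)
    (fun A B f => mcomp1m f) (fun A B f => mcompm1 f).

Definition monomorphism (C : category) (A B : obj C) (f : hom A B) : Prop :=
  forall (X : obj C) (g h : hom X A), mcomp f g = mcomp f h -> g = h.

Definition epimorphism (C : category) (A B : obj C) (f : hom A B) : Prop :=
  forall (X : obj C) (g h : hom B X), mcomp g f = mcomp h f -> g = h.

Definition zero_object (C : category) (Z : obj C) : Prop :=
  forall X : obj C,
    (exists ! f : hom X Z, True) /\ (exists ! f : hom Z X, True).

Record preadditive (C : category) := Preadditive {
  madd : forall A B : obj C, hom A B -> hom A B -> hom A B;
  mzero : forall A B : obj C, hom A B;
  mopp : forall A B : obj C, hom A B -> hom A B;
  maddA : forall A B, associative (@madd A B);
  maddC : forall A B, commutative (@madd A B);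
  madd0m : forall A B, left_id (mzero A B) (@madd A B);
  maddNm : forall A B, left_inverse (mzero A B) (@mopp A B) (@madd A B);
  mcompDl : forall A B D (g h : hom B D) (f : hom A B),
    mcomp (madd g h) f = madd (mcomp g f) (mcomp h f);
  mcompDr : forall A B D (g : hom B D) (f h : hom A B),
    mcomp g (madd f h) = madd (mcomp g f) (mcomp g h)
}.

Section Preadditive.
Variables (C : category) (P : preadditive C).

Definition is_kernel (K A B : obj C) (f : hom A B) (k : hom K A) : Prop :=
  mcomp f k = mzero P K B /\
  forall (X : obj C) (h : hom X A), mcomp f h = mzero P X B ->
    exists ! u : hom X K, mcomp k u = h.

Definition is_cokernel (A B Q : obj C) (f : hom A B) (q : hom B Q) : Prop :=
  mcomp q f = mzero P A Q /\
  forall (X : obj C) (h : hom B X), mcomp h f = mzero P A X ->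
    exists ! u : hom Q X, mcomp u q = h.

Definition is_biproduct (A B S : obj C) (i1 : hom A S) (i2 : hom B S)
    (p1 : hom S A) (p2 : hom S B) : Prop :=
  [/\ mcomp p1 i1 = idm A, mcomp p2 i2 = idm B &
      madd P (mcomp i1 p1) (mcomp i2 p2) = idm S].

Record abelian_axioms : Prop := AbelianAxioms {
  has_zero_object : exists Z : obj C, zero_object Z;
  has_biproducts : forall A B : obj C,
    exists (S : obj C) (i1 : hom A S) (i2 : hom B S)
           (p1 : hom S A) (p2 : hom S B), is_biproduct i1 i2 p1 p2;
  has_kernels : forall (A B : obj C) (f : hom A B),
    exists (K : obj C) (k : hom K A), is_kernel f k;
  has_cokernels : forall (A B : obj C) (f : hom A B),
    exists (Q : obj C) (q : hom B Q), is_cokernel f q;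
  mono_normal : forall (A B : obj C) (f : hom A B), monomorphism f ->
    exists (D : obj C) (g : hom B D), is_kernel g f;
  epi_conormal : forall (A B : obj C) (f : hom A B), epimorphism f ->
    exists (D : obj C) (g : hom D A), is_cokernel g f
}.

End Preadditive.

(* Being abelian is a property of the bare category: the additive structure is
   determined by the biproducts, so it is only required to exist. *)
Definition abelian_category (C : category) : Prop :=
  exists P : preadditive C, abelian_axioms P.

(* Rings are [pzRingType]s: the zero ring is allowed. *)

Lemma linear_ext (R : pzRingType) (U V : lmodType R) (f g : {linear U -> V}) :
  f =1 g -> f = g.
Proof.
case: f g => [f [[fD] [fZ]]] [g [[gD] [gZ]]] /= /funext fg.
move: fD fZ gD gZ; rewrite fg => fD fZ gD gZ.
by rewrite (Prop_irrelevance fD gD) (Prop_irrelevance fZ gZ).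
Qed.

Definition lmod_category (R : pzRingType) : category.
Proof.
refine (@Category (lmodType R) (fun U V => {linear U -> V})
  (fun U => idfun : {linear U -> U})
  (fun U V W g f => g \o f : {linear U -> W}) _ _ _);
by move=> *; apply: linear_ext.
Defined.

Definition projective (R : pzRingType) (P : lmodType R) : Prop :=
  forall (M N : lmodType R) (p : {linear M -> N}) (f : {linear P -> N}),
    (forall y, exists x, p x = y) ->
    exists g : {linear P -> M}, forall x, p (g x) = f x.

Definition injective_module (R : pzRingType) (E : lmodType R) : Prop :=
  forall (M N : lmodType R) (i : {linear M -> N}) (f : {linear M -> E}),
    injective i ->
    exists g : {linear N -> E}, forall x, g (i x) = f x.

Definition projective_category (R : pzRingType) : category :=
  @full_subcategory (lmod_category R) (@projective R).

(* A submodule of [M] is an [N : submodClosed M], i.e. a predicate on [M] closed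
   under the module operations; left ideals are submodules of [R^o].  Predicates
   are boolean, which is no restriction by the axioms of [boolp]. *)

Section SubmoduleType.
Variables (R : pzRingType) (M : lmodType R) (N : submodClosed M).

Record submod_type := SubmodType { submod_val : M; _ : submod_val \in N }.

HB.instance Definition _ := [isSub for submod_val].
HB.instance Definition _ := [Choice of submod_type by <:].
HB.instance Definition _ := [SubChoice_isSubLmodule of submod_type by <:].

End SubmoduleType.

Definition essential (R : pzRingType) (M E : lmodType R)
    (i : {linear M -> E}) : Prop :=
  forall N : submodClosed E, (exists2 x, x \in N & x != 0) ->
    exists2 m, i m \in N & i m != 0.

Definition injective_envelope (R : pzRingType) (M E : lmodType R)
    (i : {linear M -> E}) : Prop :=
  [/\ injective i, essential i & injective_module E].

(* Injective envelopes are unique up to isomorphism. *)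
Definition left_QF3plus (R : pzRingType) : Prop :=
  exists (E : lmodType R) (i : {linear R^o -> E}),
    injective_envelope i /\ projective E.

Definition left_hereditary (R : pzRingType) : Prop :=
  forall I : submodClosed R^o, projective (submod_type I).

Definition simple_module (R : pzRingType) (M : lmodType R) : Prop :=
  (exists x : M, x != 0) /\
  forall N : submodClosed M,
    (forall x, x \in N -> x = 0) \/ (forall x, x \in N).

(* [M] is the sum of its simple submodules. *)
Definition semisimple_module (R : pzRingType) (M : lmodType R) : Prop :=
  forall x : M, exists2 s : seq M,
    x = \sum_(y <- s) y &
    forall y, y \in s ->
      exists2 S : submodClosed M, simple_module (submod_type S) & y \in S.

Definition semisimple_ring (R : pzRingType) : Prop :=
  forall M : lmodType R, semisimple_module M.

(* Main.v *)
From mathcomp Require Import all_boot all_algebra.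
From HB Require Import structures.
From mathcomp Require Import boolp classical_sets.
Require Import Defs.

(** If projective modules form an abelian category, the inclusion [I -> R] of a
    left ideal has a cokernel [e : R -> J] there.  An epimorphism [A -> R] of
    projectives is surjective, because the inclusion of its image, a projective
    left ideal, is both mono and epi, hence invertible; pulling [e] back along
    the maps [R -> J] shows that [e] is surjective too.  As [J] is projective,
    [e] splits and [I], its kernel, is a direct summand of [R].  If some [x] were
    outside the socle of [M], then for a maximal left ideal [N] containing
    [{r | r x \in socle M}] and a complement [R e] of [N], the module [R e x],
    isomorphic to [R / N], would be simple, forcing [e \in N].  Conversely, over
    a semisimple ring every linear map [f] satisfies [f \o g \o f = f] for some
    [g], so that all modules are projective and kernels, cokernels and the two
    normality axioms come from the idempotents [g \o f] and [f \o g]. *)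

Set Implicit Arguments.
Unset Strict Implicit.
Unset Printing Implicit Defensive.

Import GRing.Theory.
Local Open Scope ring_scope.

Local Notation "g \c f" := (mcomp g f) (at level 40, left associativity).

(** * Abelian categories: factorisation and pullback of epimorphisms *)

Section AbelianCategory.
Variables (C : category) (P : preadditive C).

Lemma maddm0 (A B : obj C) (f : hom A B) : madd P f (mzero P A B) = f.
Proof. by rewrite maddC madd0m. Qed.

Lemma maddI (A B : obj C) (f g h : hom A B) :
  madd P f g = madd P f h -> g = h.
Proof.
move=> /(congr1 (madd P (mopp P f))).
by rewrite !maddA maddNm !madd0m.
Qed.

Lemma mcomp0m (A B D : obj C) (f : hom A B) :
  mzero P B D \c f = mzero P A D.
Proof.
by apply: (@maddI _ _ (mzero P B D \c f)); rewrite -mcompDl madd0m maddm0.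
Qed.

Lemma mcompm0 (A B D : obj C) (f : hom B D) :
  f \c mzero P A B = mzero P A D.
Proof.
by apply: (@maddI _ _ (f \c mzero P A B)); rewrite -mcompDr madd0m maddm0.
Qed.

(** Composing the decomposition of the identity of [S] with [i1] gives [i1 = i1 + i2 p2 i1]; cancel
    [i1], then [i2] by means of [p2]. *)
Lemma biproduct_p2i1 (A B S : obj C) (i1 : hom A S) (i2 : hom B S)
    (p1 : hom S A) (p2 : hom S B) :
  is_biproduct P i1 i2 p1 p2 -> p2 \c i1 = mzero P A B.
Proof.
case=> p1i1 p2i2 e.
have /(congr1 (mcomp p2)) : i2 \c (p2 \c i1) = mzero P A S.
  apply: (@maddI _ _ i1); rewrite maddm0.
  by rewrite -[RHS]mcomp1m -e mcompDl -!mcompA p1i1 mcompm1.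
by rewrite mcompA p2i2 mcomp1m mcompm0.
Qed.

Lemma cokernel_epi (A B Q : obj C) (f : hom A B) (q : hom B Q) :
  is_cokernel P f q -> epimorphism q.
Proof.
move=> [qf0 univ] X g h gh.
have [|u [_ uniq]] := univ X (h \c q); first by rewrite -mcompA qf0 mcompm0.
by rewrite -(uniq g gh) -(uniq h erefl).
Qed.

Hypothesis ab : abelian_axioms P.

(** [f] is the kernel of some [g]; as [f] is epi, [g f = 0] forces [g = 0], so the identity of [B]
    factors through [f]. *)
Lemma mono_epi_split (A B : obj C) (f : hom A B) :
  monomorphism f -> epimorphism f -> exists u : hom B A, f \c u = idm B.
Proof.
move=> fmono fepi; have [D [g [gf0 univ]]] := mono_normal ab fmono.
have g0 : g = mzero P B D by apply: fepi; rewrite gf0 mcomp0m.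
have [|u [fu _]] := univ B (idm B); last by exists u.
by rewrite g0 mcomp0m.
Qed.

(** [e] is the cokernel of some [g]; since [e g = 0], this [g] factors through [k], so [h] kills
    [g]. *)
Lemma epi_factor (K A B X : obj C) (e : hom A B) (k : hom K A) (h : hom A X) :
  epimorphism e -> is_kernel P e k -> h \c k = mzero P K X ->
  exists s : hom B X, s \c e = h.
Proof.
move=> eepi [_ kuniv] hk0; have [D [g [eg0 univ]]] := epi_conormal ab eepi.
have [v [kv _]] := kuniv D g eg0.
have [|s [se _]] := univ X h; last by exists s.
by rewrite -kv mcompA hk0 mcomp0m.
Qed.

(** The pullback is the kernel of [(e, -y)] on the biproduct of [A] and [X], a map that is epi
    because its restriction to [A] is [e]. *)
Lemma epi_pullback (A B X : obj C) (e : hom A B) (y : hom X B) :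
  epimorphism e -> exists (W : obj C) (p : hom W X) (q : hom W A),
    epimorphism p /\ e \c q = y \c p.
Proof.
move=> eepi; have [S [i1 [i2 [p1 [p2 bi]]]]] := has_biproducts ab A X.
have p2i1 := biproduct_p2i1 bi; case: bi => p1i1 p2i2 _.
pose m := madd P (e \c p1) (mopp P y \c p2).
have mi1 : m \c i1 = e.
  by rewrite mcompDl -!mcompA p1i1 p2i1 mcompm1 mcompm0 maddm0.
have mepi : epimorphism m.
  by move=> Z g h gh; apply: eepi; rewrite -mi1 !mcompA gh.
have [W [k kerk]] := has_kernels ab m.
exists W, (p2 \c k), (p1 \c k); split.
  move=> Z g h; rewrite !mcompA => gh.
  (* [t p2] kills the kernel of [m], hence equals some [s m]. Restricting to [A] gives [s e = 0], so
     [s = 0]; restricting to [X] gives [t = 0]. *)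
  pose t := madd P g (mopp P h).
  have t0 : t \c (p2 \c k) = mzero P W Z.
    rewrite mcompA !mcompDl gh -!mcompDl.
    by rewrite [madd P h _]maddC maddNm !mcomp0m.
  have [|s sm] := epi_factor mepi kerk (h := t \c p2).
    by rewrite -mcompA.
  have s0 : s = mzero P B Z.
    by apply: eepi; rewrite -mi1 mcompA sm -mcompA p2i1 mcompm0 mcomp0m.
  have tz : t = mzero P X Z.
    by rewrite -[t]mcompm1 -p2i2 mcompA -sm s0 !mcomp0m.
  apply: (@maddI _ _ (mopp P h)).
  by rewrite maddNm maddC.
case: kerk => mk0 _.
have yyk : madd P (mopp P y \c p2 \c k) (y \c p2 \c k) = mzero P W B.
  by rewrite -!mcompDl maddNm !mcomp0m.
move: mk0; rewrite mcompDl => mk0.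
by rewrite !mcompA -[LHS]maddm0 -yyk maddA mk0 madd0m.
Qed.

End AbelianCategory.

(** * Submodules and linear maps built from propositional data *)

Section Modules.
Variable R : pzRingType.
Implicit Types U V M : lmodType R.

Lemma submodB M (N : submodClosed M) x y : x \in N -> y \in N -> x - y \in N.
Proof. by move=> xN yN; rewrite -scaleN1r rpredD ?rpredZ. Qed.

Lemma submod_exists M (Q : M -> Prop) :
  Q 0 -> (forall a x y, Q x -> Q y -> Q (a *: x + y)) ->
  exists N : submodClosed M, forall x, x \in N <-> Q x.
Proof.
move=> Q0 QD; pose p : {pred M} := fun x => `[< Q x >].
have pE x : x \in p <-> Q x by split=> /asboolP.
have pc : GRing.submod_closed p.
  by split=> [|a x y /pE px /pE py]; apply/pE => //; apply: QD.
pose N : submodClosed M :=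
  HB.pack_for (submodClosed M) p (GRing.isSubmodClosed.Build R M p pc).
by exists N.
Qed.

Lemma linear_exists U V (h : U -> V) :
  linear h -> exists k : {linear U -> V}, k =1 h.
Proof.
move=> lh; pose k : {linear U -> V} :=
  HB.pack_for {linear U -> V} h (GRing.isLinear.Build R U V *:%R h lh).
by exists k.
Qed.

Lemma linear_corestrict U V (N : submodClosed V) (h : {linear U -> V}) :
  (forall x, h x \in N) ->
  exists u : {linear U -> submod_type N}, forall x, val (u x) = h x.
Proof.
move=> hN; have [u uE] : exists u : {linear U -> submod_type N},
    u =1 fun x => SubmodType (hN x).
  by apply: linear_exists => a x y; apply: val_inj => /=; exact: linearP.
by exists u => x; rewrite uE.
Qed.

Lemma scaler_linear M (y : M) :
  exists k : {linear R^o -> M}, forall r : R, k r = r *: y.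
Proof.
by apply: linear_exists => a u v; rewrite scalerDl scalerA.
Qed.

Lemma projective_regular : @projective R R^o.
Proof.
move=> M N p f psurj; have [x px] := psurj (f 1).
have [g gE] := scaler_linear x; exists g => r.
by rewrite gE linearZ px -linearZ /= [X in f X]mulr1.
Qed.

Lemma linear_kernel U V (f : {linear U -> V}) :
  exists K : submodClosed U, forall x, x \in K <-> f x = 0.
Proof.
apply: submod_exists; first exact: linear0.
by move=> a x y fx fy; rewrite linearP fx fy scaler0 addr0.
Qed.

Lemma linear_image U V (f : {linear U -> V}) :
  exists K : submodClosed V, forall y, y \in K <-> exists x, f x = y.
Proof.
apply: submod_exists; first by exists 0; rewrite linear0.
move=> a _ _ [x <-] [y <-]; exists (a *: x + y); exact: linearP.
Qed.

(** * Zorn's lemma and complements in semisimple modules *)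

Lemma maximal_avoiding M (A : submodClosed M) (B : M -> Prop) :
  (forall x, x \in A -> ~ B x) ->
  exists N : submodClosed M, [/\ {subset A <= N}, forall x, x \in N -> ~ B x &
    forall L : submodClosed M, {subset N <= L} ->
      (forall x, x \in L -> ~ B x) -> {subset L <= N}].
Proof.
move=> AB.
(* Only a nonempty [X] has to contain [A], so that the empty set, the union of the empty chain,
   satisfies [Q]. *)
pose Q (X : set M) := [/\ forall x, X x -> ~ B x,
  forall x a, X x -> a \in A -> X a &
  forall a x y, X x -> X y -> X (a *: x + y)].
have QS (L : submodClosed M) : {subset A <= L} ->
    (forall x, x \in L -> ~ B x) -> Q [set x | x \in L]%classic.
  move=> AL LB; split=> //= [x a _ /AL //|a x y xL yL].
  by rewrite rpredD ?rpredZ.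
have [|X [[XB XA XD] Xmax]] := @Zorn_bigcup M Q.
  move=> F FQ Ftot; split=> [x [X FX Xx]|x a [X FX Xx] aA|a x y].
  - by have [+ _ _] := FQ X FX; apply.
  - by exists X => //; have [_ + _] := FQ X FX; apply; eauto.
  - move=> [X FX Xx] [Y FY Yy].
    case: (Ftot X Y FX FY) => [XY|YX].
      by exists Y => //; have [_ _] := FQ Y FY; apply=> //; apply: XY.
    by exists X => //; have [_ _] := FQ X FX; apply=> //; apply: YX.
have Xsup (L : submodClosed M) : {subset A <= L} ->
    (forall x, x \in L -> ~ B x) -> (forall x, X x -> x \in L) ->
    forall x, x \in L -> X x.
  move=> AL LB XL x xL; apply: contrapT => nXx.
  apply: (Xmax [set x | x \in L]%classic); last exact: QS.
  by split=> [y /XL|/(_ x xL)].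
(* Any element of [X] brings in all of [A], hence [0]. An empty [X] lies in [A], and maximality
   against [A] again yields [0]. *)
have X0 : X 0.
  have [//|nX0] := pselect (X 0); exfalso; apply: (nX0).
  apply: (Xsup A) => //; last exact: rpred0.
  by move=> x Xx; case: nX0; apply: XA Xx (rpred0 A).
have [N NE] := submod_exists X0 XD.
exists N; split=> [a aA|x /NE/XB//|L NL LB x xL].
  by apply/NE/(XA 0).
apply/NE; apply: (Xsup L) => // [a aA|y /NE/NL//].
by apply/NL/NE/(XA 0).
Qed.

(** Take [C] maximal among submodules meeting [N] in [0]. A simple [S] meets [C + N] in [0] or in
    all of [S]; in the first case [C + S] still meets [N] in [0], so [S] lies in [C]. *)
Lemma semisimple_complement M (N : submodClosed M) : semisimple_module M ->
  exists C : submodClosed M, (forall x, x \in C -> x \in N -> x = 0) /\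
    forall x, exists2 c, c \in C & x - c \in N.
Proof.
move=> ssM.
have [Z ZE] : exists Z : submodClosed M, forall x, x \in Z <-> x = 0.
  by apply: submod_exists => // a x y -> ->; rewrite scaler0 addr0.
have [|C [_ CN Cmax]] := @maximal_avoiding M Z (fun x => x \in N /\ x <> 0).
  by move=> x /ZE -> [].
have CN0 x : x \in C -> x \in N -> x = 0.
  by move=> xC xN; apply: contrapT => x0; apply: (CN x xC).
exists C; split=> //.
have [T TE] : exists T : submodClosed M,
    forall x, x \in T <-> exists2 c, c \in C & x - c \in N.
  apply: submod_exists; first by exists 0; rewrite ?subr0 rpred0.
  move=> a x y [c cC xc] [d dC yd]; exists (a *: c + d).
    by rewrite rpredD ?rpredZ.
  by rewrite opprD addrACA -scalerBr rpredD ?rpredZ.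
suff ST (S : submodClosed M) y : simple_module (submod_type S) ->
    y \in S -> y \in T.
  move=> x; apply/TE; have [s -> sS] := ssM x.
  rewrite big_seq; apply: rpred_sum => y /sS[S]; exact: ST.
move=> [_ simS] yS.
have [T' T'E] : exists T' : submodClosed (submod_type S),
    forall s, s \in T' <-> val s \in T.
  apply: submod_exists; first by rewrite linear0 rpred0.
  by move=> a s t sT tT; rewrite linearP rpredD ?rpredZ.
case: (simS T') => [T'0|T'S]; last by have /T'E := T'S (SubmodType yS).
have [L LE] : exists L : submodClosed M,
    forall x, x \in L <-> exists2 c, c \in C & x - c \in S.
  apply: submod_exists; first by exists 0; rewrite ?subr0 rpred0.
  move=> a x z [c cC xc] [d dC yd]; exists (a *: c + d).
    by rewrite rpredD ?rpredZ.
  by rewrite opprD addrACA -scalerBr rpredD ?rpredZ.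
have CL : {subset C <= L}.
  by move=> c cC; apply/LE; exists c; rewrite // subrr rpred0.
have LC : {subset L <= C}.
  apply: Cmax => // x /LE[c cC xcS] [xN]; apply.
  (* [x - c] lies in [S] and, being [-c] plus an element of [N], also in [C + N]. *)
  have /(congr1 val)/= xc : SubmodType xcS = 0.
    apply: T'0; apply/T'E/TE => /=; exists (- c).
      by rewrite -sub0r submodB ?rpred0.
    by rewrite opprK subrK.
  by move/eqP: xc; rewrite subr_eq0 => /eqP xc; apply: CN0; rewrite // xc.
apply/TE; exists y; last by rewrite subrr rpred0.
by apply/LC/LE; exists 0; rewrite ?subr0 ?rpred0.
Qed.

(** [g] projects onto the image of [f] along a complement [D], then inverts [f] on a complement [C]
    of its kernel. *)
Lemma semisimple_regular U V (f : {linear U -> V}) : semisimple_ring R ->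
  exists g : {linear V -> U}, forall x, f (g (f x)) = f x.
Proof.
move=> ss; have [K KE] := linear_kernel f; have [I IE] := linear_image f.
have [C [CK CKU]] := semisimple_complement K (ss U).
have [D [DI DIV]] := semisimple_complement I (ss V).
have lift y : exists c, c \in C /\ y - f c \in D.
  have [d dD /IE[x fx]] := DIV y; have [c cC /KE fc] := CKU x.
  exists c; split=> //.
  move/eqP: fc; rewrite linearB subr_eq0 => /eqP <-.
  by rewrite fx opprB addrC subrK.
(* The default [0] is never taken, by [lift]. *)
pose g y := xget 0 [set c | c \in C /\ y - f c \in D]%classic.
have gP y : g y \in C /\ y - f (g y) \in D.
  rewrite /g; case: xgetP => [c _ //|nc]; have [c /nc] := lift y; by [].
have gU y c : c \in C -> y - f c \in D -> g y = c.
  move=> cC ycD; have [gC gD] := gP y; apply/eqP; rewrite -subr_eq0; apply/eqP.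
  apply: CK; [exact: submodB|apply/KE; apply: DI; last by apply/IE; eexists].
  have -> : f (g y - c) = (y - f c) - (y - f (g y)).
    by rewrite linearB opprB [RHS]addrC addrA subrK.
  exact: submodB.
have [k kE] : exists k : {linear V -> U}, k =1 g.
  apply: linear_exists => a y z; have [yC yD] := gP y; have [zC zD] := gP z.
  apply: gU; first by rewrite rpredD ?rpredZ.
  by rewrite linearP opprD addrACA -scalerBr rpredD ?rpredZ.
exists k => x; rewrite kE; have [_ gD] := gP (f x).
apply/eqP; rewrite eq_sym -subr_eq0; apply/eqP; apply: DI => //.
by apply/IE; exists (x - g (f x)); rewrite linearB.
Qed.

(** For a surjective [p], the equation [p g p = p] makes [g] a section of [p]. *)
Lemma semisimple_projective M : semisimple_ring R -> projective M.
Proof.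
move=> ss U V p f psurj; have [g gE] := semisimple_regular p ss.
exists (g \o f) => x /=; have [u <-] := psurj (f x); exact: gE.
Qed.

(** * The socle, and semisimplicity from direct summands *)

Definition socle M (x : M) : Prop := exists2 s : seq M,
  x = \sum_(y <- s) y &
  forall y, y \in s ->
    exists2 S : submodClosed M, simple_module (submod_type S) & y \in S.

Lemma socle_closed M a (x y : M) : socle x -> socle y -> socle (a *: x + y).
Proof.
move=> [s -> sS] [t -> tS]; exists ([seq a *: z | z <- s] ++ t).
  by rewrite big_cat big_map scaler_sumr.
move=> z; rewrite mem_cat => /orP[/mapP[w /sS[S simS wS] ->]|/tS //].
by exists S => //; rewrite rpredZ.
Qed.

(** [N] is a maximal left ideal and the image a copy of [R / N]. The preimage [L] of a submodule
    contains [N], so it contains [1] or lies in [N]. *)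
Lemma image_simple M (N : submodClosed R^o) (f : {linear R^o -> M})
    (S : submodClosed M) :
  1 \notin N ->
  (forall L : submodClosed R^o, {subset N <= L} ->
     1 \notin L -> {subset L <= N}) ->
  (forall r, r \in N <-> f r = 0) -> (forall y, y \in S <-> exists r, f r = y) ->
  simple_module (submod_type S).
Proof.
move=> N1 Nmax NE SE; split.
  have f1S : f 1 \in S by apply/SE; exists 1.
  exists (SubmodType f1S); apply: contra N1 => /eqP/(congr1 val)/= f10.
  exact/NE.
move=> T; have [L LE] : exists L : submodClosed R^o,
    forall r, r \in L <-> exists2 s, s \in T & val s = f r.
  apply: submod_exists; first by exists 0; rewrite ?rpred0 ?linear0.
  move=> a x y [s sT sx] [t tT ty]; exists (a *: s + t).
    by rewrite rpredD ?rpredZ.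
  by rewrite !linearP; congr (_ *: _ + _).
have NL : {subset N <= L}.
  by move=> r /NE fr; apply/LE; exists 0; rewrite ?rpred0 ?linear0.
have [/LE[s sT sE]|L1] := boolP (1 \in L); [right|left] => t.
  have /SE[r fr] := valP t.
  suff -> : t = r *: s by rewrite rpredZ.
  apply: val_inj; rewrite linearZ /= sE -fr -linearZ /=.
  by congr (f _); rewrite [RHS]mulr1.
move=> tT; have /SE[r fr] := valP t.
apply: val_inj; rewrite linear0 -fr.
by apply/NE; apply: (Nmax L NL L1); apply/LE; exists t.
Qed.

(** The hypothesis encodes direct summands: right multiplication by [v] is a projection of [R] onto
    [I]. *)
Lemma semisimple_of_summands :
  (forall I : submodClosed R^o, exists2 v : R, v \in I &
     forall x : R, x \in I -> x * v = x) ->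
  semisimple_ring R.
Proof.
move=> summand M x; change (socle x).
apply: contrapT => nx.
have soc0 : socle (0 : M) by exists [::]; rewrite ?big_nil.
have [A AE] : exists A : submodClosed R^o, forall r : R, r \in A <-> socle (r *: x).
  apply: submod_exists; first by rewrite scale0r.
  move=> a r s rx sx; rewrite scalerDl -scalerA; exact: socle_closed.
have [|N [AN N1 Nmax]] := @maximal_avoiding R^o A (fun r => r = 1).
  by move=> r rA r1; move: rA; rewrite r1 => /AE; rewrite scale1r.
have [v vN vE] := summand N; pose e : R := 1 - v.
have rE (r : R) : r * e = r - r * v by rewrite mulrBr mulr1.
have [f fE] := scaler_linear (e *: x).
(* If [r e x = 0], then [r e] is in [A], hence in [N], and so is [r = r e + r v]. *)
have keq (r : R) : r \in N <-> f r = 0.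
  rewrite fE scalerA rE; split=> [/vE ->|re0]; first by rewrite subrr scale0r.
  have rvN : r * v \in N by apply: rpredZ.
  have : r - r * v \in N by apply/AN/AE; rewrite re0.
  move=> reN; have -> : r = (r - r * v) + r * v by rewrite subrK.
  by apply: (rpredD (S := N)).
have [S SE] := linear_image f.
have simS : simple_module (submod_type S).
  apply: image_simple keq SE; first by apply/negP => /N1.
  move=> L NL L1; apply: Nmax => // r rL r1; move: L1.
  by rewrite -r1 rL.
have eN : e \in N.
  apply/AN/AE; exists [:: e *: x]; first by rewrite big_seq1.
  move=> y /[!inE]/eqP ->; exists S => //; apply/SE; exists 1.
  by rewrite fE scale1r.
apply: (N1 1) => //; have -> : 1 = e + v by rewrite subrK.
exact: (rpredD (S := N)).
Qed.

End Modules.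

(** * The category of projective modules: if abelian, left ideals are direct summands *)

Section ProjectiveCategory.
Variable R : pzRingType.
Local Notation Pr := (projective_category R).

Definition projective_obj (M : lmodType R) (h : projective M) : obj Pr :=
  exist (@projective R) M h.

Section AbelianImpliesSummands.
Variables (P : preadditive Pr) (hered : left_hereditary R).

Definition regular : obj Pr := projective_obj (@projective_regular R).

(** [P] is arbitrary, so its zero is identified by precomposing with the zero linear map: the
    composite is [mzero] and also vanishes everywhere. *)
Lemma mzeroE (A B : obj Pr) x : (mzero P A B : {linear sval A -> sval B}) x = 0.
Proof.
have <- : mzero P A B \c (\0%R : {linear sval A -> sval A}) = mzero P A B.
  exact: mcomp0m.
exact: linear0.
Qed.

Hypothesis ab : abelian_axioms P.

(** Reaching [1] amounts to surjectivity, the image being a left ideal; heredity makes that image an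
    object of the category. *)
Lemma epi_regular_surjective (A : obj Pr) (f : hom A regular) :
  epimorphism f -> exists a, (f : {linear sval A -> R^o}) a = 1.
Proof.
move=> fepi; have [L LE] := linear_image (f : {linear sval A -> R^o}).
pose I : obj Pr := projective_obj (@hered L).
pose i : hom I regular := (\val : {linear submod_type L -> R^o}).
have imono : monomorphism i.
  move=> X g h gh; apply: linear_ext => x; apply: val_inj.
  exact: (congr1 (fun k : {linear sval X -> R^o} => k x) gh).
have iepi : epimorphism i.
  move=> X g h gh; apply: fepi; apply: linear_ext => a /=.
  have faL : f a \in L by apply/LE; exists a.
  exact: (congr1 (fun k : {linear submod_type L -> sval X} => k (SubmodType faL)) gh).
have [u iu] := mono_epi_split ab imono iepi.
apply/LE; have <- : val ((u : {linear R^o -> submod_type L}) 1) = 1.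
  exact: (congr1 (fun k : {linear R^o -> R^o} => k 1) iu).
exact: valP.
Qed.

Lemma abelian_summand (I : submodClosed R^o) :
  exists2 v : R, v \in I & forall x : R, x \in I -> x * v = x.
Proof.
pose IP : obj Pr := projective_obj (@hered I).
pose i : hom IP regular := (\val : {linear submod_type I -> R^o}).
have imono : monomorphism i.
  move=> X g h gh; apply: linear_ext => x; apply: val_inj.
  exact: (congr1 (fun k : {linear sval X -> R^o} => k x) gh).
have [D [g [gi0 guniv]]] := mono_normal ab imono.
have [J [e cok]] := has_cokernels ab i.
have eepi := cokernel_epi cok; case: cok => ei0 euniv.
(* [g] factors through [e], so whatever [e] kills is killed by [g], whose kernel is [i]. *)
have [u [ue _]] := euniv D g gi0.
pose e' : {linear R^o -> sval J} := e.
have ker_e (x : R) : e' x = 0 -> x \in I.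
  move=> ex0; have [m mE] := scaler_linear (x : R^o).
  have em0 : e \c (m : hom regular regular) = mzero P regular J.
    apply: linear_ext => r; rewrite mzeroE /= -/e' mE linearZ ex0.
    exact: scaler0.
  have [|w [iw _]] := guniv regular m.
    by rewrite -ue -mcompA em0 mcompm0.
  have <- : val ((w : {linear R^o -> submod_type I}) 1) = x.
    transitivity (m 1); last by rewrite mE; exact: mul1r.
    exact: (congr1 (fun k : {linear R^o -> R^o} => k 1) iw).
  exact: valP.
have esurj y : exists r, e' r = y.
  have [m mE] := scaler_linear y.
  (* Pull [e] back along the map sending [1] to [y]; then [q] carries a [w] lying over [1] to a
     preimage of [y]. *)
  have [W [p [q [pepi eq]]]] := epi_pullback ab (m : hom regular J) eepi.
  have [w pw] := epi_regular_surjective pepi.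
  exists ((q : {linear sval W -> R^o}) w); rewrite -[RHS]scale1r -mE -pw.
  exact: (congr1 (fun k : {linear sval W -> sval J} => k w) eq).
have [s es] := (svalP J) _ _ e' (idfun : {linear sval J -> sval J}) esurj.
have eval (x : R) : x \in I -> e' x = 0.
  by move=> xI; rewrite -(@mzeroE IP J (SubmodType xI)) -ei0.
(* The value at [1] of the projection [1 - s e] of [R] onto [I]. *)
exists (1 - s (e' 1)).
  by apply: ker_e; rewrite linearB /= es subrr.
move=> x xI; rewrite mulrBr mulr1.
have -> : x * s (e' 1) = s (e' x).
  by rewrite -[x in RHS]mulr1 !linearZ.
by rewrite eval // linear0 subr0.
Qed.

End AbelianImpliesSummands.

(** * Over a semisimple ring the category is abelian *)

Section SemisimpleImpliesAbelian.
Hypothesis ss : semisimple_ring R.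

Definition semisimple_obj (M : lmodType R) : obj Pr :=
  projective_obj (semisimple_projective (M := M) ss).

Definition linear_preadditive : preadditive Pr.
Proof.
refine (@Preadditive Pr
  (fun A B (f g : {linear sval A -> sval B}) => (f \+ g : {linear _ -> _}))
  (fun A B => (\0%R : {linear sval A -> sval B}))
  (fun A B (f : {linear sval A -> sval B}) => (\- f : {linear _ -> _}))
  _ _ _ _ _ _).
- by move=> A B f g h; apply: linear_ext => x /=; rewrite addrA.
- by move=> A B f g; apply: linear_ext => x /=; rewrite addrC.
- by move=> A B f; apply: linear_ext => x /=; rewrite add0r.
- by move=> A B f; apply: linear_ext => x /=; rewrite addNr.
- by move=> A B D g h f; apply: linear_ext.
- by move=> A B D g f h; apply: linear_ext => x /=; rewrite linearD.
Defined.

Lemma homE (A B : obj Pr) (f g : {linear sval A -> sval B}) :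
  (f : hom A B) = g -> f =1 g.
Proof. by move=> ->. Qed.

Lemma linear_has_kernel (A B : obj Pr) (f : {linear sval A -> sval B}) :
  exists (K : obj Pr) (k : hom K A), is_kernel linear_preadditive (f : hom A B) k.
Proof.
have [K KE] := linear_kernel f.
exists (semisimple_obj (submod_type K)).
exists (\val : {linear submod_type K -> sval A}); split.
  by apply: linear_ext => x /=; apply/KE; apply: valP.
move=> X h /homE fh0.
have hK x : h x \in K by apply/KE; apply: fh0.
have [u uE] := linear_corestrict hK.
exists u; split; first by apply: linear_ext => x; apply: uE.
move=> v /homE vE; apply: linear_ext => x; apply: val_inj.
by rewrite uE; apply/esym/vE.
Qed.

(** [f g] is idempotent with the same image as [f], so its kernel is a complement of that image and
    serves as the cokernel, with [1 - f g] as the quotient map. *)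
Lemma linear_has_cokernel (A B : obj Pr) (f : {linear sval A -> sval B}) :
  exists (Q : obj Pr) (q : hom B Q),
    is_cokernel linear_preadditive (f : hom A B) q.
Proof.
have [g fgf] := semisimple_regular f ss.
have [K KE] := linear_kernel (f \o g).
have qK y : (idfun \- (f \o g)) y \in K.
  by apply/KE => /=; rewrite !linearB /= fgf subrr.
have [q qE] := linear_corestrict qK.
exists (semisimple_obj (submod_type K)), q; split.
  by apply: linear_ext => x; apply: val_inj; rewrite [LHS]qE /= fgf subrr.
move=> X h /homE hf0.
pose k : hom (semisimple_obj (submod_type K)) B :=
  (\val : {linear submod_type K -> sval B}).
exists (h \c k); split.
  apply: linear_ext => y; rewrite /= qE /= linearB.
  by move: (hf0 (g y)) => /= ->; rewrite subr0.
move=> v /homE vE; apply: linear_ext => x; rewrite /= -vE /=.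
congr (v _); apply: val_inj; rewrite qE /=.
by have /KE/= -> := valP x; rewrite subr0.
Qed.

Lemma semisimple_abelian : abelian_category Pr.
Proof.
exists linear_preadditive; split.
- exists (semisimple_obj 'rV[R]_0) => X; split.
    exists (\0%R : {linear sval X -> 'rV[R]_0}); split=> // f _.
    by apply: linear_ext => x; rewrite [LHS]thinmx0 [RHS]thinmx0.
  exists (\0%R : {linear 'rV[R]_0 -> sval X}); split=> // f _.
  by apply: linear_ext => x; rewrite [x]thinmx0 !linear0.
- move=> A B; exists (semisimple_obj (sval A * sval B)%type).
  have [i1 i1E] : exists i : {linear sval A -> (sval A * sval B)%type},
      forall x, i x = (x, 0).
    by apply: linear_exists => a x y; congr pair; rewrite /= scaler0 addr0.
  have [i2 i2E] : exists i : {linear sval B -> (sval A * sval B)%type},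
      forall x, i x = (0, x).
    by apply: linear_exists => a x y; congr pair; rewrite /= scaler0 addr0.
  exists i1, i2, (@fst _ _ : {linear (sval A * sval B)%type -> sval A}),
    (@snd _ _ : {linear (sval A * sval B)%type -> sval B}).
  split; apply: linear_ext => x /=; rewrite ?i1E ?i2E //.
  by case: x => x y; congr pair; rewrite /= ?addr0 ?add0r.
- exact: linear_has_kernel.
- exact: linear_has_cokernel.
- move=> A B f fmono; have [g fgf] := semisimple_regular f ss.
  (* Cancelling the mono [f] in [f g f = f] gives [g f = 1], and then [f] is the kernel of
     [1 - f g]. *)
  have gf : (g : hom B A) \c f = idm A.
    by apply: fmono; apply: linear_ext => x; apply: fgf.
  exists B, (idfun \- (f \o g) : {linear sval B -> sval B}).
  split; first by apply: linear_ext => x /=; rewrite fgf subrr.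
  move=> X h /homE fgh; exists ((g : hom B A) \c h); split.
    apply: linear_ext => x; apply/eqP; rewrite eq_sym -subr_eq0; apply/eqP.
    exact: fgh.
  move=> v vE; apply: linear_ext => x.
  by rewrite /= -vE -[RHS](homE gf).
- move=> A B f fepi; have [g fgf] := semisimple_regular f ss.
  (* Dually [f g = 1], and [f] is the cokernel of [1 - g f]. *)
  have fg : f \c (g : hom B A) = idm B.
    by apply: fepi; apply: linear_ext => x; apply: fgf.
  exists A, (idfun \- (g \o f) : {linear sval A -> sval A}).
  split; first by apply: linear_ext => x /=; rewrite linearB /= fgf subrr.
  move=> X h /homE hgf; exists (h \c (g : hom B A)); split.
    apply: linear_ext => x; apply/eqP; rewrite eq_sym -subr_eq0.
    by have /= := hgf x; rewrite linearB /= => ->.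
  move=> v vE; apply: linear_ext => x.
  by rewrite /= -vE /=; congr (v _); apply: (homE fg).
Qed.

End SemisimpleImpliesAbelian.

End ProjectiveCategory.

Theorem corollary3p7 (R : pzRingType) (hered : left_hereditary R)
    (qf3 : left_QF3plus R) :
  abelian_category (projective_category R) <-> semisimple_ring R.
Proof.
split=> [[P ab]|]; last exact: semisimple_abelian.
by apply: semisimple_of_summands; apply: abelian_summand ab.
Qed.
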